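(* Let $n\geqslant 1$. For any element $\varphi\in \mathrm{Isom}_e(K_0(\mathbb{P}_n)\otimes\mathbb{R})$ there exists $F_\varphi\in K_0(\mathbb{P}_n)\otimes\mathbb{R}$ such that $\varphi(E)=E\otimes F_\varphi$ for all $E\in K_0(\mathbb{P}_n)\otimes\mathbb{R}$.
   Context: $K_0(\mathbb{P}_n)$ is the Grothendieck group of coherent sheaves on the $n$-dimensional projective space $\mathbb{P}_n$ over a fixed ground field; it is a free $\mathbb{Z}$-module of rank $n+1$ with basis the classes of $\mathcal{O},\mathcal{O}(1),\dots,\mathcal{O}(n)$. A sheaf and its class are denoted by the same letter. The Euler form is the (nonsymmetric) nondegenerate bilinear form $\chi(E,F)=\sum_\nu(-1)^\nu\dim\mathrm{Ext}^\nu(E,F)$; it satisfies $\chi(\mathcal{O}(k),\mathcal{O}(m))=\binom{n+m-k}{n}$ for all $k,m\in\mathbb{Z}$, where $\binom{x}{n}=\frac{x(x-1)\cdots(x-n+1)}{n!}$. It is extended $\mathbb{R}$-bilinearly to $K_0(\mathbb{P}_n)\otimes\mathbb{R}$. $\mathrm{Isom}(K_0(\mathbb{P}_n)\otimes\mathbb{R})\subset GL(n+1,\mathbb{R})$ is the group of $\mathbb{R}$-linear automorphisms of $K_0(\mathbb{P}_n)\otimes\mathbb{R}$ preserving $\chi$, and $\mathrm{Isom}_e(K_0(\mathbb{P}_n)\otimes\mathbb{R})$ is its connected component of the identity. The symbol $\otimes$ between classes denotes the commutative ring structure on $K_0(\mathbb{P}_n)$ (extended to $K_0(\mathbb{P}_n)\otimes\mathbb{R}$)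 induced by tensor product of locally free sheaves; it is the bilinear product with $\mathcal{O}(k)\otimes\mathcal{O}(m)=\mathcal{O}(k+m)$ for all $k,m\in\mathbb{Z}$. *)

(* Defs.v *)
From HB Require Import structures.
From mathcomp Require Import all_boot all_order all_algebra.
From mathcomp Require Import all_classical all_reals all_analysis.

Set Implicit Arguments.
Unset Strict Implicit.
Unset Printing Implicit Defensive.

Import Order.TTheory GRing.Theory Num.Theory.
Import numFieldNormedType.Exports.

Local Open Scope classical_set_scope.
Local Open Scope ring_scope.

(* binom(x, n) = x (x - 1) ... (x - n + 1) / n! for x in Z; the division is
   exact by [binzE]. *)
Definition binz (x : int) (n : nat) : int :=
  ((\prod_(i < n) (x - i%:Z)) %/ n`!%:Z)%Z.

(* K_0(P_n) (x) A: coordinate vectors on the basis O, O(1), ..., O(n),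
   so that K0 int n is K_0(P_n) itself. *)
Definition K0 (A : Type) (n : nat) : Type := 'rV[A]_n.+1.

(* Gram matrix chi(O(i), O(j)) = binom(n + j - i, n), 0 <= i, j <= n. *)
Definition euler_gram (n : nat) : 'M[int]_n.+1 :=
  \matrix_(i, j) binz (n%:Z + j%:Z - i%:Z) n.

Definition chi (A : comUnitRingType) (n : nat) (E F : K0 A n) : A :=
  (E *m map_mx intr (euler_gram n) *m F^T) 0 0.

(* The coordinates of O(k) for arbitrary k in Z: chi being unimodular, O(k) is
   the only class v with chi(O(i), v) = binom(n + k - i, n) for 0 <= i <= n. *)
Definition O_int (n : nat) (k : int) : K0 int n :=
  (\row_i binz (n%:Z + k - i%:Z) n) *m invmx (euler_gram n)^T.

Definition OO (A : comUnitRingType) (n : nat) (k : int) : K0 A n :=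
  map_mx intr (O_int n k).

(* The bilinear product with O(i) (x) O(j) = O(i + j) on the basis;
   [tens_OO] extends this rule to all twists. *)
Definition tens (A : comUnitRingType) (n : nat) (E F : K0 A n) : K0 A n :=
  \sum_i \sum_j (E 0 i * F 0 j) *: OO A n (i%:Z + j%:Z).

(* A matrix phi stands for the endomorphism E |-> E *m phi. *)
Definition Isom (R : realType) (n : nat) : set 'M[R]_n.+1 :=
  [set phi | phi \in unitmx /\
     forall E F : K0 R n, chi (E *m phi : K0 R n) (F *m phi : K0 R n) = chi E F].

Definition Isom_e (R : realType) (n : nat) : set 'M[R]_n.+1 :=
  connected_component (@Isom R n) 1%:M.

Arguments Isom : clear implicits.
Arguments Isom_e : clear implicits.

(* Sanity checks: the above satisfies the rules that determine K_0(P_n), its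
   Euler form and its product, and is the only such structure. *)

Lemma binzE x n : \prod_(i < n) (x - i%:Z) = binz x n * n`!%:Z.
Proof.
rewrite /binz divzK //.
have ff m : (n`!%:Z %| (m ^_ n)%N%:Z)%Z by rewrite -bin_ffact PoszM dvdz_mull.
case: x => m.
  suff -> : \prod_(i < n) (m%:Z - i%:Z) = (m ^_ n)%N%:Z by [].
  rewrite ffact_prod; have [le_nm|lt_mn] := leqP n m.
    rewrite -[RHS]natz natr_prod; apply: eq_bigr => i _.
    by rewrite natrB ?natz // (leq_trans _ le_nm) // ltnW.
  rewrite (bigD1 (Ordinal lt_mn)) //= subrr mul0r.
  by rewrite (bigD1 (Ordinal lt_mn)) //= subnn mul0n.
suff -> : \prod_(i < n) (Negz m - i%:Z) = (-1) ^+ n * ((m + n) ^_ n)%N%:Z.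
  by rewrite dvdz_mull.
rewrite ffact_prod -[((\prod_(_ < _) _)%N)%:Z]natz natr_prod.
have -> : (-1) ^+ n = \prod_(i < n) (-1) :> int by rewrite prodr_const card_ord.
rewrite -big_split /= [RHS](reindex_inj rev_ord_inj) /=.
apply: eq_bigr => i _.
have -> : (m + n - (n - i.+1) = m.+1 + i)%N.
  by rewrite -addnBA ?leq_subr // subKn // addnS addSn.
by rewrite NegzE natrD !natz mulN1r opprD.
Qed.

Lemma binz_bin (m n : nat) : binz m%:Z n = 'C(m, n).
Proof.
apply: (@mulIf _ n`!%:Z); first by rewrite eqz_nat -lt0n fact_gt0.
rewrite -binzE -PoszM bin_ffact ffact_prod.
have [le_nm|lt_mn] := leqP n m.
  rewrite -[RHS]natz natr_prod; apply: eq_bigr => i _.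
  by rewrite natrB ?natz // (leq_trans _ le_nm) // ltnW.
rewrite (bigD1 (Ordinal lt_mn)) //= subrr mul0r.
by rewrite (bigD1 (Ordinal lt_mn)) //= subnn mul0n.
Qed.

Lemma euler_gram_unit n : euler_gram n \in unitmx.
Proof.
rewrite -unitmx_tr unitmxE det_trig; last first.
  apply/is_trig_mxP => i j lt_ij; rewrite !mxE.
  have -> : n%:Z + i%:Z - j%:Z = (n + i - j)%N.
    by rewrite -PoszD subzn // (leq_trans (leq_ord j)) // leq_addr.
  rewrite binz_bin bin_small // ltn_subLR; first by rewrite addnC ltn_add2r.
  by rewrite (leq_trans (leq_ord j)) // leq_addr.
rewrite big1 ?unitr1 // => i _.
by rewrite !mxE addrK binz_bin binn.
Qed.

Lemma O_int_gram n k :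
  O_int n k *m (euler_gram n)^T = \row_i binz (n%:Z + k - i%:Z) n.
Proof. by rewrite /O_int mulmxKV // unitmx_tr euler_gram_unit. Qed.

Lemma O_int_basis n (i : 'I_n.+1) : O_int n i%:Z = delta_mx 0 i.
Proof.
rewrite /O_int -[RHS](@mulmxK _ _ _ (euler_gram n)^T) ?unitmx_tr ?euler_gram_unit //.
by congr (_ *m _); apply/rowP => j; rewrite -rowE !mxE.
Qed.

(* Every coordinate of O(k) is a polynomial of degree at most n in k. *)
Lemma O_int_poly n (j : 'I_n.+1) : exists2 p : {poly rat},
  (size p <= n.+1)%N & forall k : int, p.[k%:~R] = (O_int n k 0 j)%:~R.
Proof.
pose B (i : 'I_n.+1) : {poly rat} := n`!%:R^-1 *:
  \prod_(l < n) ('X - (i%:Z + l%:Z - n%:Z)%:~R%:P).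
have sB i : (size (B i) <= n.+1)%N.
  by rewrite (leq_trans (size_scale_leq _ _)) // size_prod_XsubC /index_enum
    -enumT size_enum_ord.
have BE i (x : int) : (B i).[x%:~R] = (binz (n%:Z + x - i%:Z) n)%:~R.
  have nz : n`!%:R != 0 :> rat by rewrite pnatr_eq0 -lt0n fact_gt0.
  apply: (mulfI nz); rewrite /B hornerZ mulrA divff // mul1r horner_prod.
  rewrite -[n`!%:R]/((n`!%:Z)%:~R) -intrM mulrC -binzE rmorph_prod /=.
  apply: eq_bigr => l _; rewrite !hornerE -intrB; congr (_%:~R).
  by rewrite !opprB !opprD !addrA; rewrite addrAC [x + _]addrC addrAC.
exists (\sum_i (invmx (euler_gram n)^T i j)%:~R *: B i).
  rewrite (leq_trans (size_sum _ _ _)) //; apply/bigmax_leqP => i _.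
  by rewrite (leq_trans (size_scale_leq _ _)).
move=> k; rewrite horner_sum mxE rmorph_sum /=; apply: eq_bigr => i _.
by rewrite hornerZ BE mxE intrM mulrC.
Qed.

(* The coordinates of O(k) are the Lagrange interpolation weights at the nodes
   0, ..., n. *)
Lemma O_int_interp n (k : int) (p : {poly rat}) : (size p <= n.+1)%N ->
  \sum_j (O_int n k 0 j)%:~R * p.[j%:R] = p.[k%:~R].
Proof.
move=> sp; have /fin_all_exists2[L sL LE] := @O_int_poly n.
pose q : {poly rat} := \sum_(j < n.+1) p.[j%:R] *: L j - p.
have sq : (size q <= n.+1)%N.
  rewrite (leq_trans (size_polyD _ _)) // geq_max size_polyN sp andbT.
  rewrite (leq_trans (size_sum _ _ _)) //; apply/bigmax_leqP => i _.
  by rewrite (leq_trans (size_scale_leq _ _)).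
have qE (x : int) :
    q.[x%:~R] = \sum_j (O_int n x 0 j)%:~R * p.[j%:R] - p.[x%:~R].
  rewrite hornerD hornerN horner_sum; congr (_ - _); apply: eq_bigr => j _.
  by rewrite hornerZ LE mulrC.
suff q0 : q = 0 by apply/eqP; rewrite -subr_eq0 -qE q0 horner0.
apply/eqP; apply: contraTT sq => nzq; rewrite -ltnNge.
pose rs : seq rat := [seq i%:R | i <- iota 0 n.+1].
have -> : n.+1 = size rs by rewrite size_map size_iota.
apply: max_poly_roots => //.
  apply/allP => _ /mapP[i + ->]; rewrite mem_iota /= => lti.
  rewrite /root -[_%:R]/((i%:Z)%:~R) qE subr_eq0.
  rewrite (bigD1 (Ordinal lti)) //= (O_int_basis (Ordinal lti)) mxE !eqxx mul1r.
  by rewrite big1 ?addr0 // => j /negPf ne; rewrite mxE ne andbF mul0r.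
rewrite map_inj_uniq ?iota_uniq // => i j /eqP.
by rewrite eqr_nat => /eqP.
Qed.

Lemma OO_int n k : OO int n k = O_int n k.
Proof. by apply/rowP => j; rewrite mxE intz. Qed.

Lemma OO_basis (A : comUnitRingType) n (i : 'I_n.+1) :
  OO A n i%:Z = delta_mx 0 i.
Proof. by rewrite /OO O_int_basis map_delta_mx. Qed.

Lemma chi_OO (A : comUnitRingType) n k m :
  chi (OO A n k) (OO A n m) = (binz (n%:Z + m - k) n)%:~R.
Proof.
rewrite /chi /OO map_trmx -!map_mxM mxE; congr (_%:~R).
rewrite -mulmxA -[euler_gram n]trmxK -trmx_mul O_int_gram mxE.
apply: (@intr_inj rat); rewrite rmorph_sum /=.
have nz : n`!%:R != 0 :> rat by rewrite pnatr_eq0 -lt0n fact_gt0.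
pose p : {poly rat} := n`!%:R^-1 *: ((-1) ^+ n *:
  \prod_(l < n) ('X - (n%:Z + m - l%:Z)%:~R%:P)).
have pE (x : int) : p.[x%:~R] = (binz (n%:Z + m - x) n)%:~R.
  apply: (mulfI nz); rewrite /p !hornerZ mulVKf // horner_prod.
  rewrite -[n`!%:R]/((n`!%:Z)%:~R) -intrM [n`!%:Z * _]mulrC.
  have -> : (-1) ^+ n = \prod_(i < n) (-1) :> rat by rewrite prodr_const card_ord.
  rewrite -binzE rmorph_prod /= -big_split /=.
  apply: eq_bigr => l _; rewrite !hornerE -intrB mulN1r -intrN; congr (_%:~R).
  by rewrite opprB addrAC.
rewrite -pE -(@O_int_interp n).
  by apply: eq_bigr => j _; rewrite intrM !mxE -[j%:R]/((j%:Z)%:~R) pE.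
rewrite (leq_trans (size_scale_leq _ _)) // (leq_trans (size_scale_leq _ _)) //.
by rewrite size_prod_XsubC /index_enum -enumT size_enum_ord.
Qed.

Lemma chiDl (A : comUnitRingType) n (a : A) (E E' F : K0 A n) :
  chi (a *: E + E' : K0 A n) F = a * chi E F + chi E' F.
Proof. by rewrite /chi !mulmxDl -!scalemxAl !mxE. Qed.

Lemma chiDr (A : comUnitRingType) n (a : A) (E F F' : K0 A n) :
  chi E (a *: F + F' : K0 A n) = a * chi E F + chi E F'.
Proof. by rewrite /chi linearP /= mulmxDr -scalemxAr !mxE. Qed.

Lemma chi_nondegl (A : comUnitRingType) n (E : K0 A n) :
  (forall F, chi E F = 0) -> E = 0.
Proof.
move=> E0; have gu : map_mx intr (euler_gram n) \in @unitmx A n.+1.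
  by rewrite unitmxE det_map_mx rmorph_unit // -unitmxE euler_gram_unit.
rewrite -[LHS](mulmxK gu) (_ : E *m _ = 0) ?mul0mx //; apply/rowP => j.
have := E0 (delta_mx 0 j); rewrite /chi trmx_delta -colE mxE => ->.
by rewrite mxE.
Qed.

Lemma chi_nondegr (A : comUnitRingType) n (F : K0 A n) :
  (forall E, chi E F = 0) -> F = 0.
Proof.
move=> F0; have gu : map_mx intr (euler_gram n) \in @unitmx A n.+1.
  by rewrite unitmxE det_map_mx rmorph_unit // -unitmxE euler_gram_unit.
apply: trmx_inj; rewrite -[LHS](mulKmx gu) trmx0 (_ : _ *m F^T = 0) ?mulmx0 //.
apply/colP => i; have := F0 (delta_mx 0 i).
by rewrite /chi -mulmxA -rowE mxE => ->; rewrite mxE.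
Qed.

Lemma tensC (A : comUnitRingType) n (E F : K0 A n) : tens E F = tens F E.
Proof.
rewrite /tens exchange_big; apply: eq_bigr => j _; apply: eq_bigr => i _.
by rewrite mulrC addrC.
Qed.

Lemma tensDl (A : comUnitRingType) n (a : A) (E E' F : K0 A n) :
  tens (a *: E + E' : K0 A n) F = a *: tens E F + tens E' F.
Proof.
rewrite /tens scaler_sumr -big_split; apply: eq_bigr => i _ /=.
rewrite scaler_sumr -big_split; apply: eq_bigr => j _ /=.
by rewrite !mxE scalerA -scalerDl mulrA mulrDl.
Qed.

Lemma O_int_shift n (k m : int) :
  \sum_i O_int n k 0 i *: O_int n (i%:Z + m) = O_int n (k + m).
Proof.
apply/rowP => l; have [p sp pE] := O_int_poly l.
apply: (@intr_inj rat); rewrite summxE rmorph_sum /= -pE.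
have -> : p.[(k + m)%:~R] = (p \Po ('X + m%:~R%:P)).[k%:~R].
  by rewrite horner_comp !hornerE intrD.
rewrite -(@O_int_interp n) ?size_comp_poly2 ?size_XaddC //.
apply: eq_bigr => i _; rewrite mxE intrM horner_comp !hornerE -pE intrD.
by [].
Qed.

Lemma tens_OO (A : comUnitRingType) n k m :
  tens (OO A n k) (OO A n m) = OO A n (k + m).
Proof.
rewrite /OO -O_int_shift /tens map_mx_sum; apply: eq_bigr => i _.
rewrite addrC -O_int_shift scaler_sumr map_mx_sum; apply: eq_bigr => j _.
by rewrite /OO !map_mxZ !mxE scalerA [i%:Z + _]addrC.
Qed.

Lemma K0_expand (A : comUnitRingType) n (E : K0 A n) :
  E = \sum_i E 0 i *: OO A n i%:Z.
Proof.
by rewrite [LHS]row_sum_delta; apply: eq_bigr => i _; rewrite OO_basis.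
Qed.

Lemma tens_suml (A : comUnitRingType) n (I : finType) (c : I -> A)
    (X : I -> K0 A n) F :
  tens (\sum_i c i *: X i : K0 A n) F = \sum_i c i *: tens (X i) F.
Proof.
have t0 : tens (0 : K0 A n) F = 0.
  rewrite /tens big1 // => i _; rewrite big1 // => j _.
  by rewrite mxE mul0r scale0r.
elim/big_ind2: _ => [|x y x' y' <- <-|i _]; first exact: t0.
- by rewrite -[x in x + _]scale1r tensDl scale1r.
- by rewrite -[X in tens X]addr0 tensDl t0 addr0.
Qed.

Lemma tens_sumr (A : comUnitRingType) n (I : finType) (c : I -> A)
    (X : I -> K0 A n) E :
  tens E (\sum_i c i *: X i : K0 A n) = \sum_i c i *: tens E (X i).
Proof.
by rewrite tensC tens_suml; apply: eq_bigr => i _; rewrite tensC.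
Qed.

Lemma tensA (A : comUnitRingType) n (E F G : K0 A n) :
  tens (tens E F) G = tens E (tens F G).
Proof.
rewrite [E]K0_expand !tens_suml; apply: eq_bigr => i _; congr (_ *: _).
rewrite [F]K0_expand tens_sumr !tens_suml tens_sumr.
apply: eq_bigr => j _; congr (_ *: _).
rewrite [G]K0_expand !tens_sumr; apply: eq_bigr => k _; congr (_ *: _).
by rewrite !tens_OO addrA.
Qed.

Lemma tens1 (A : comUnitRingType) n (E : K0 A n) : tens (OO A n 0) E = E.
Proof.
rewrite tensC [X in tens X _]K0_expand tens_suml [RHS]K0_expand.
by apply: eq_bigr => i _; rewrite tens_OO addr0.
Qed.

Lemma K0_unique n (K : zmodType) (o : int -> K) (c : K -> K -> int)
    (mul : K -> K -> K) :
  (forall x, exists! a : 'rV[int]_n.+1, x = \sum_(i < n.+1) o i%:Z *~ a 0 i) ->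
  (forall y, {morph c^~ y : x x' / x + x'}) ->
  (forall x, {morph c x : y y' / y + y'}) ->
  (forall k m, c (o k) (o m) = binz (n%:Z + m - k) n) ->
  (forall y, {morph mul^~ y : x x' / x + x'}) ->
  (forall x, {morph mul x : y y' / y + y'}) ->
  (forall k m, mul (o k) (o m) = o (k + m)) ->
  exists f : K0 int n -> K,
    [/\ bijective f, {morph f : x y / x + y},
        forall k, f (OO int n k) = o k,
        forall x y, c (f x) (f y) = chi x y
      & forall x y, mul (f x) (f y) = f (tens x y)].
Proof.
move=> basis cDl cDr cO mDl mDr mO.
pose f (a : K0 int n) : K := \sum_(i < n.+1) o i%:Z *~ a 0 i.
have morphE (U V : zmodType) (h : U -> V) : {morph h : x y / x + y} ->
    forall (x : 'I_n.+1 -> U) (a : 'I_n.+1 -> int),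
    h (\sum_i x i *~ a i) = \sum_i h (x i) *~ a i.
  move=> hD x a.
  have h0 : h 0 = 0 by apply: (addrI (h 0)); rewrite -hD !addr0.
  have hN u : h (- u) = - h u.
    by apply: (addrI (h u)); rewrite -hD !subrr h0.
  have hn u (m : nat) : h (u *+ m) = h u *+ m.
    by elim: m => [|m IH]; rewrite ?h0 // !mulrS hD IH.
  rewrite (big_morph h hD h0); apply: eq_bigr => i _.
  by case: (a i) => m; rewrite ?NegzE -?pmulrn ?mulrNz ?hN -?pmulrn hn.
have fD : {morph f : x y / x + y}.
  move=> x y; rewrite /f -big_split; apply: eq_bigr => i _ /=.
  by rewrite mxE mulrzDr.
have f_inj : injective f.
  move=> x y exy; have [a [_ ua]] := basis (f x).
  by rewrite -(ua x) // -(ua y).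
have fB (i : 'I_n.+1) : f (OO int n i%:Z) = o i%:Z.
  rewrite /f OO_basis (bigD1 i) //= mxE !eqxx big1 ?addr0 ?mulr1z //.
  by move=> j /negPf ne; rewrite mxE ne andbF mulr0z.
have xE (x : K0 int n) : x = \sum_(i < n.+1) OO int n i%:Z *~ x 0 i.
  by rewrite [LHS]K0_expand; apply: eq_bigr => i _; rewrite -scaler_int intz.
have chil (x y : K0 int n) :
    chi x y = \sum_(i < n.+1) chi (OO int n i%:Z) y *~ x 0 i.
  rewrite [x in LHS]xE; apply: (morphE _ _ (fun x : K0 int n => chi x y)).
  by move=> u v; rewrite -{1}[u]scale1r chiDl mul1r.
have chir (x y : K0 int n) :
    chi x y = \sum_(i < n.+1) chi x (OO int n i%:Z) *~ y 0 i.
  rewrite [y in LHS]xE; apply: (morphE _ _ (fun y : K0 int n => chi x y)).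
  by move=> u v; rewrite -{1}[u]scale1r chiDr mul1r.
have cl x y : c (f x) y = \sum_(i < n.+1) c (o i%:Z) y *~ x 0 i.
  exact: (morphE _ _ _ (cDl y)).
have cr x y : c x (f y) = \sum_(i < n.+1) c x (o i%:Z) *~ y 0 i.
  exact: (morphE _ _ _ (cDr x)).
have chi_f x y : c (f x) (f y) = chi x y.
  rewrite cl chil; apply: eq_bigr => i _; rewrite cr chir; congr (_ *~ _).
  by apply: eq_bigr => j _; rewrite cO chi_OO intz.
have f_surj x : exists a, f a = x by have [a [-> _]] := basis x; exists a.
have fO k : f (OO int n k) = o k.
  have [a fa] := f_surj (o k); rewrite -fa; congr f.
  apply/eqP; rewrite -subr_eq0; apply/eqP; apply: chi_nondegr => E.
  rewrite addrC -scaleN1r chiDr mulN1r addrC -!chi_f fa.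
  rewrite chi_f chil cl -sumrB big1 // => i _.
  by rewrite chi_OO cO intz subrr.
exists f; split => //.
  have /choice[g gE] := f_surj; exists g => // x; exact: f_inj.
move=> x y; transitivity (\sum_(i < n.+1) mul (o i%:Z) (f y) *~ x 0 i).
  exact: (morphE _ _ _ (mDl _)).
transitivity (\sum_(i < n.+1) f (tens (OO int n i%:Z) y) *~ x 0 i); last first.
  rewrite [x in RHS]xE; symmetry.
  apply: (morphE _ _ (fun x : K0 int n => f (tens x y))).
  by move=> u v; rewrite -{1}[u]scale1r tensDl scale1r fD.
apply: eq_bigr => i _; congr (_ *~ _).
transitivity (\sum_(j < n.+1) mul (o i%:Z) (o j%:Z) *~ y 0 j).
  exact: (morphE _ _ _ (mDr _)).
rewrite tensC [y in RHS]xE; symmetry.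
rewrite (morphE _ _ (fun x : K0 int n => f (tens x (OO int n i%:Z)))).
  by apply: eq_bigr => j _; rewrite mO tens_OO fO addrC.
by move=> u v; rewrite -{1}[u]scale1r tensDl scale1r fD.
Qed.

(* Main.v *)
(* Connectedness plays no role: every isometry is a twist. Serre duality
   chi(E, F) = (-1)^n chi(F, E (x) O(-n-1)) and nondegeneracy of chi force an
   isometry phi to commute with tensoring by O(-n-1), hence by O(-(n+1)m) for
   all natural m. The coordinates of O(k) are polynomials in k, so the identity
   phi(O(k)) = phi(O) (x) O(k), valid for infinitely many k, holds for all k,
   and F = phi(O) works on the basis O, ..., O(n). *)

Require Import Defs.
From mathcomp Require Import all_boot all_order all_algebra.
From mathcomp Require Import all_classical all_reals all_analysis.
From mathcomp Require Import ring.
Import GRing.Theory Num.Theory.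
Local Open Scope ring_scope.

(** Reversing the order of the [n] factors turns each of them into the negative of a factor
    [x - i]. *)
Lemma binz_opp (x : int) (n : nat) :
  binz (n%:Z - 1 - x) n = (-1) ^+ n * binz x n.
Proof.
apply: (@mulIf _ n`!%:Z); first by rewrite eqz_nat -lt0n fact_gt0.
rewrite -mulrA -!binzE.
have -> : (-1) ^+ n = \prod_(i < n) (-1) :> int by rewrite prodr_const card_ord.
rewrite -big_split /= (reindex_inj rev_ord_inj) /=.
apply: eq_bigr => i _; by rewrite -subzn // -addn1 PoszD; ring.
Qed.

Lemma chi_suml (A : comUnitRingType) (n : nat) (I : finType)
    (c : I -> A) (X : I -> K0 A n) (F : K0 A n) :
  chi (\sum_i c i *: X i : K0 A n) F = \sum_i c i * chi (X i) F.
Proof.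
rewrite /chi !mulmx_suml summxE; apply: eq_bigr => i _.
by rewrite -!scalemxAl mxE.
Qed.

Lemma chi_sumr (A : comUnitRingType) (n : nat) (I : finType)
    (c : I -> A) (X : I -> K0 A n) (E : K0 A n) :
  chi E (\sum_i c i *: X i : K0 A n) = \sum_i c i * chi E (X i).
Proof.
rewrite /chi linear_sum /= mulmx_sumr summxE; apply: eq_bigr => i _.
by rewrite linearZ /= -scalemxAr mxE.
Qed.

(** Serre duality, with O(-n-1) as canonical class. Bilinearity reduces it to basis twists, where it
    is the reflection [binz_opp]. *)
Lemma chi_serre (A : comUnitRingType) (n : nat) (E F : K0 A n) :
  chi E F = (-1) ^+ n * chi F (tens E (OO A n (- n.+1%:Z))).
Proof.
rewrite [E in RHS]K0_expand tens_suml chi_sumr [E in LHS]K0_expand chi_suml.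
rewrite mulr_sumr; apply: eq_bigr => i _; rewrite mulrCA; congr (_ * _).
rewrite [F in RHS]K0_expand [F in LHS]K0_expand chi_suml chi_sumr.
rewrite mulr_sumr; apply: eq_bigr => j _; rewrite mulrCA; congr (_ * _).
rewrite tens_OO !chi_OO.
have -> : n%:Z + (i%:Z - n.+1%:Z) - j%:Z = n%:Z - 1 - (n%:Z + j%:Z - i%:Z).
  by rewrite intS; ring.
by rewrite binz_opp rmorphM /= rmorphXn /= rmorphN1 signrMK.
Qed.

(** The twists O(dm) span: a linear form [c], evaluated at O(k), is a polynomial in k, and vanishing
    at all multiples of [d] makes it zero. *)
Lemma OO_multiples_span (R : numFieldType) (n : nat) (d : int)
    (c : 'I_n.+1 -> R) : d != 0 ->
  (forall m : nat, \sum_j OO R n (d * m%:Z) 0 j * c j = 0) ->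
  forall j, c j = 0.
Proof.
move=> nzd c0; have /fin_all_exists2[L _ LE] := @O_int_poly n.
pose q : {poly R} := \sum_j c j *: map_poly ratr (L j).
have qE (k : int) : q.[k%:~R] = \sum_j OO R n k 0 j * c j.
  rewrite horner_sum; apply: eq_bigr => j _.
  by rewrite hornerZ -(ratr_int R k) horner_map LE /= ratr_int [in RHS]mxE mulrC.
have q0 : q = 0.
  apply/eqP; apply: contraT => nzq.
  (* These are [size q] distinct roots, one more than the degree of a nonzero [q] permits. *)
  pose rs : seq R := [seq (d * i%:Z)%:~R | i : nat <- iota 0 (size q)].
  suff : (size rs < size q)%N by rewrite size_map size_iota ltnn.
  apply: max_poly_roots => //.
    by apply/allP => _ /mapP[i _ ->]; rewrite /root qE c0.
  rewrite map_inj_uniq ?iota_uniq // => i j /intr_inj /(mulfI nzd).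
  by case.
move=> j; have := qE j%:Z; rewrite q0 horner0 OO_basis (bigD1 j) //= mxE !eqxx.
rewrite mul1r big1 ?addr0 // => i /negPf ne.
by rewrite mxE ne andbF mul0r.
Qed.

Lemma Isom_twist (R : realType) (n : nat) (phi : 'M[R]_n.+1) (E : K0 R n) :
  Isom R n phi -> E *m phi = tens E (OO R n 0 *m phi).
Proof.
move=> [uphi iso].
have serreC (E' : K0 R n) : tens E' (OO R n (- n.+1%:Z)) *m phi
    = tens (E' *m phi : K0 R n) (OO R n (- n.+1%:Z)).
  (* Pair both sides with [F], written as the image under [phi] of its preimage; Serre duality then
     moves the twist away, leaving an instance of [iso]. *)
  apply/eqP; rewrite -subr_eq0; apply/eqP; apply: chi_nondegr => F.
  rewrite addrC -scaleN1r chiDr mulN1r addrC -[F](mulmxKV uphi) iso.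
  apply/eqP; rewrite subr_eq0; apply/eqP.
  apply: (@mulfI _ ((-1) ^+ n)); first by rewrite signr_eq0.
  by rewrite -!chi_serre iso.
have twistC (m : nat) : OO R n (- n.+1%:Z * m%:Z) *m phi
    = tens (OO R n 0 *m phi : K0 R n) (OO R n (- n.+1%:Z * m%:Z)).
  elim: m => [|m IH]; first by rewrite mulr0 tensC tens1.
  have -> : - n.+1%:Z * m.+1%:Z = - n.+1%:Z * m%:Z - n.+1%:Z.
    by rewrite -[m.+1]addn1 PoszD mulrDr mulr1.
  by rewrite -tens_OO serreC IH tensA.
have basisC (j : 'I_n.+1) :
    OO R n j%:Z *m phi = tens (OO R n 0 *m phi : K0 R n) (OO R n j%:Z).
  apply/rowP => l; apply/eqP; rewrite -subr_eq0; apply/eqP.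
  (* For fixed [l], the [l]-th coordinate of the difference of the two sides is a linear form in the
     class replacing O(j); [twistC] makes it vanish on the multiples of -n-1. *)
  move: j; apply: (@OO_multiples_span R n (- n.+1%:Z)) => [//|m].
  transitivity ((OO R n (- n.+1%:Z * m%:Z) *m phi) 0 l
      - tens (OO R n 0 *m phi : K0 R n) (OO R n (- n.+1%:Z * m%:Z)) 0 l);
    last by rewrite twistC subrr.
  set k := - n.+1%:Z * m%:Z; rewrite [in RHS](K0_expand (OO R n k)) tens_sumr mulmx_suml.
  rewrite !summxE -sumrB; apply: eq_bigr => j _.
  by rewrite -scalemxAl !mxE mulrBr.
rewrite [E]K0_expand mulmx_suml tens_suml; apply: eq_bigr => j _.
by rewrite -scalemxAl basisC tensC.
Qed.

Theorem proposition4 (R : realType) (n : nat) (hn : (1 <= n)%N)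
    (phi : 'M[R]_n.+1) (hphi : Isom_e R n phi) :
  exists F : K0 R n, forall E : K0 R n, E *m phi = tens E F.
Proof.
exists (OO R n 0 *m phi) => E; apply: Isom_twist.
exact: connected_component_sub hphi.
Qed.
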